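(* Let $n\ge1$, $\Delta>0$, $\varepsilon_{\mathrm{tot}}>0$, $\delta_{\mathrm{tot}}\in(0,1)$, and let $L=L_{\mathrm{in}}+L_{\mathrm{out}}$ with integers $L_{\mathrm{in}},L_{\mathrm{out}}\ge1$. Consider the repeated IN/OUT release family under uniform Basic Composition with total budget $(\varepsilon_{\mathrm{tot}},\delta_{\mathrm{tot}})$ (defined in the context). Then any unbiased estimator $\hat x_j$ of the target record $x_j$ satisfies $$\mathrm{MSE}(\hat x_j)\ \ge\ \frac{8L\ln(1.25L/\delta_{\mathrm{tot}})\,\Delta^2}{\varepsilon_{\mathrm{tot}}^2}.$$ If $L$ is even, equality is attained by the balanced split $L_{\mathrm{in}}=L_{\mathrm{out}}=L/2$ together with the estimator $\hat x_j=(n+1)\bar y_{\mathrm{in}}-n\bar y_{\mathrm{out}}$. For odd $L$, the nearest balanced integer split ($\{L_{\mathrm{in}},L_{\mathrm{out}}\}=\{(L-1)/2,(L+1)/2\}$) changes the bound by the factor $L^2/(L^2-1)$, i.e. the minimum MSE over unbiased estimators under that split equals the right-hand side above multiplied by $L^2/(L^2-1)$.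
   Context: Repeated IN/OUT family: unknown scalar records $\bm x=(x_1,\dots,x_N)\in\mathbb{R}^N$, a target index $j$, a background set $B\subseteq\{1,\dots,N\}\setminus\{j\}$ with $|B|=n$, and queries $$q_{\mathrm{in}}(\bm x)=\tfrac{1}{n+1}\Bigl(x_j+\sum_{k\in B}x_k\Bigr),\qquad q_{\mathrm{out}}(\bm x)=\tfrac1n\sum_{k\in B}x_k.$$ One observes $L_{\mathrm{in}}$ noisy copies $q_{\mathrm{in}}(\bm x)+w_\ell$ with $w_\ell\sim\mathcal N(0,\sigma_{\mathrm{in}}^2)$ and $L_{\mathrm{out}}$ noisy copies $q_{\mathrm{out}}(\bm x)+w_\ell$ with $w_\ell\sim\mathcal N(0,\sigma_{\mathrm{out}}^2)$, all noises independent; $\bar y_{\mathrm{in}},\bar y_{\mathrm{out}}$ denote the empirical means of the two blocks. Unbiasedness is required for all $\bm x$. Calibration: under record-level adjacency of radius $\Delta$ the sensitivities are $\Delta_{2,\mathrm{in}}=\Delta/(n+1)$ and $\Delta_{2,\mathrm{out}}=\Delta/n$. The Gaussian mechanism with per-release budget $(\varepsilon_\ell,\delta_\ell)$ uses variance $\sigma_\ell^2=2\ln(1.25/\delta_\ell)\Delta_{2,\ell}^2/\varepsilon_\ell^2$. Uniform Basic Composition sets $\varepsilon_\ell=\varepsilon_{\mathrm{tot}}/L$ and $\delta_\ell=\delta_{\mathrm{tot}}/L$, so that $$\sigma_{\mathrm{in}}^2=\kappa_L\frac{\Delta^2}{(n+1)^2},\qquad \sigma_{\mathrm{out}}^2=\kappa_L\frac{\Delta^2}{n^2},\qquad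 \kappa_L=\frac{2L^2\ln(1.25L/\delta_{\mathrm{tot}})}{\varepsilon_{\mathrm{tot}}^2}.$$ *)

(* Defs.v *)
From HB Require Import structures.
From mathcomp Require Import all_boot all_order all_algebra.
From mathcomp Require Import all_classical all_reals all_analysis.
From mathcomp Require Import ring.

Set Implicit Arguments.
Unset Strict Implicit.
Unset Printing Implicit Defensive.

Import Order.TTheory GRing.Theory Num.Theory.
Import numFieldNormedType.Exports.

Local Open Scope classical_set_scope.
Local Open Scope ring_scope.

Section queries.
Context {R : realType} {N : nat}.
Implicit Types (x : 'rV[R]_N) (j : 'I_N) (B : {set 'I_N}).

Definition q_in j B x : R := (x 0 j + \sum_(k in B) x 0 k) / #|B|.+1%:R.

Definition q_out B x : R := (\sum_(k in B) x 0 k) / #|B|%:R.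

Definition adjacent (Delta : R) x x' : Prop :=
  exists2 k : 'I_N, forall i, i != k -> x 0 i = x' 0 i
                  & `|x 0 k - x' 0 k| <= Delta.

(* The queries are scalar, so the L2 norm is the absolute value. *)
Definition sensitivity (Delta : R) (q : 'rV[R]_N -> R) : R :=
  sup [set r | exists x x', adjacent Delta x x' /\ r = `|q x - q x'|].

End queries.

Section sensitivity_values.
Context {R : realType} {N : nat}.

Lemma sensitivity_sum (S : {set 'I_N}) (i : 'I_N) (Delta c : R) :
  i \in S -> 0 <= Delta -> 0 < c ->
  sensitivity Delta (fun x : 'rV[R]_N => (\sum_(k in S) x 0 k) / c) = Delta / c.
Proof.
move=> iS D0 c0; rewrite /sensitivity; set A := [set r | _].
have ubA : ubound A (Delta / c).
  move=> _ [x [x' [[k kE kD] ->]]].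
  rewrite -mulrBl normrM (gtr0_norm (x := c^-1)) ?invr_gt0//.
  rewrite ler_pM2r ?invr_gt0// -sumrB.
  have [kS|kNS] := boolP (k \in S).
    rewrite (bigD1 k)//= big1 ?addr0// => l /andP[_ lk].
    by rewrite kE// subrr.
  rewrite big1 ?normr0// => l lS; rewrite kE ?subrr//.
  by apply: contraNneq kNS => <-.
have AD : A (Delta / c).
  exists (Delta *: delta_mx 0 i), 0; split.
    exists i => [l li|]; first by rewrite !mxE (negbTE li) andbF mulr0.
    by rewrite !mxE !eqxx mulr1 subr0 ger0_norm.
  rewrite -mulrBl -sumrB (bigD1 i)//= big1 => [|l /andP[_ li]]; last first.
    by rewrite !mxE (negbTE li) andbF mulr0 subr0.
  by rewrite !mxE !eqxx mulr1 subr0 addr0 ger0_norm// divr_ge0// ltW.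
apply/eqP; rewrite eq_le; apply/andP; split.
  by apply: ge_sup => //; exists (Delta / c).
by apply: ub_le_sup => //; exists (Delta / c).
Qed.

Lemma sensitivity_q_in (j : 'I_N) (B : {set 'I_N}) (Delta : R) :
  j \notin B -> 0 <= Delta ->
  sensitivity Delta (q_in j B) = Delta / #|B|.+1%:R.
Proof.
move=> jB D0; rewrite -(@sensitivity_sum (j |: B)%SET j) ?setU11//.
by congr sensitivity; apply/funext => x; rewrite /q_in big_setU1.
Qed.

Lemma sensitivity_q_out (B : {set 'I_N}) (Delta : R) :
  (0 < #|B|)%N -> 0 <= Delta ->
  sensitivity Delta (q_out B) = Delta / #|B|%:R :> R.
Proof.
move=> B0 D0; have /card_gt0P[i iB] := B0.
by rewrite -(@sensitivity_sum B i)// ltr0n.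
Qed.

End sensitivity_values.

Section calibration.
Context {R : realType}.

(* Classical calibration of the Gaussian mechanism; 5 / 4 is its constant 1.25. *)
Definition gaussian_mechanism_variance (eps delta sens : R) : R :=
  2 * ln ((5 / 4) / delta) * sens ^+ 2 / eps ^+ 2.

Definition ubc_variance (L : nat) (eps_tot delta_tot sens : R) : R :=
  gaussian_mechanism_variance (eps_tot / L%:R) (delta_tot / L%:R) sens.

End calibration.

Lemma ubc_varianceE (R : realType) (L : nat) (eps_tot delta_tot sens : R) :
  ubc_variance L eps_tot delta_tot sens =
  2 * L%:R ^+ 2 * ln ((5 / 4) * L%:R / delta_tot) / eps_tot ^+ 2 * sens ^+ 2.
Proof.
rewrite /ubc_variance /gaussian_mechanism_variance.
have -> : 5 / 4 / (delta_tot / L%:R) = 5 / 4 * L%:R / delta_tot :> R.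
  by rewrite invf_div mulrA.
by rewrite exprMn exprVn invf_div; ring.
Qed.

Section independence.
Context {d : measure_display} {Om : measurableType d} {R : realType}.
Variable P : probability Om R.

Definition mutually_independent (I : finType) (X : I -> {RV P >-> R}) : Prop :=
  forall (J : {set I}) (A : I -> set R), (forall i, measurable (A i)) ->
    P (\bigcap_(i in [set` J]) (X i @^-1` A i)) =
    (\prod_(i in J) P (X i @^-1` A i))%E.

(* The second parameter of normal_prob is the standard deviation. Laws are
   compared on Borel sets only: the library's measures are functions on all
   sets, with no meaning outside the sigma-algebra. *)
Definition centered_gaussian (variance : R) (X : {RV P >-> R}) : Prop :=
  forall A : set R, measurable A ->
    distribution P X A = normal_prob 0 (Num.sqrt variance) A.

End independence.

Section release_family.
Context {R : realType} {N : nat} (j : 'I_N) (B : {set 'I_N}).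
Context {Lin Lout : nat}.
Context {d : measure_display} {Om : measurableType d} (P : probability Om R).
Implicit Types (w : 'I_Lin + 'I_Lout -> {RV P >-> R}) (x : 'rV[R]_N).

Definition release_noise (Delta eps_tot delta_tot : R) w : Prop :=
  let v q := ubc_variance (Lin + Lout) eps_tot delta_tot
               (sensitivity Delta q) in
  [/\ forall l : 'I_Lin, centered_gaussian (v (q_in j B)) (w (inl l)),
      forall l : 'I_Lout, centered_gaussian (v (q_out B)) (w (inr l)) &
      mutually_independent w].

Definition releases w x (o : Om) : Lin.-tuple R * Lout.-tuple R :=
  ([tuple q_in j B x + w (inl l) o | l < Lin],
   [tuple q_out B x + w (inr l) o | l < Lout]).

(* Estimators are arbitrary measurable functions of all the releases, not
   only linear ones. *)
Definition unbiased w (T : Lin.-tuple R * Lout.-tuple R -> R) : Prop :=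
  measurable_fun [set: Lin.-tuple R * Lout.-tuple R] T /\
  forall x, P.-integrable [set: Om] (EFin \o (T \o releases w x)) /\
            ('E_P[T \o releases w x] = (x 0 j)%:E)%E.

Definition mse w (T : Lin.-tuple R * Lout.-tuple R -> R) x : \bar R :=
  ('E_P[fun o => ((T (releases w x o) - x 0 j) ^+ 2)%R])%E.

End release_family.

Definition empirical_mean {R : realType} {L : nat} (y : L.-tuple R) : R :=
  (\sum_(l < L) tnth y l) / L%:R.

Definition difference_estimator {R : realType} (n : nat) {Lin Lout : nat}
    (y : Lin.-tuple R * Lout.-tuple R) : R :=
  n.+1%:R * empirical_mean y.1 - n%:R * empirical_mean y.2.

Definition mse_bound {R : realType} (L : nat) (Delta eps_tot delta_tot : R) : R :=
  8 * L%:R * ln ((5 / 4) * L%:R / delta_tot) * Delta ^+ 2 / eps_tot ^+ 2.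

(* Main.v *)
Require Import Defs.
From HB Require Import structures.
From mathcomp Require Import all_boot all_order all_algebra.
From mathcomp Require Import all_classical all_reals all_analysis.
From mathcomp Require Import measurable_realfun.
From mathcomp Require Import zify ring lra.

Set Implicit Arguments.
Unset Strict Implicit.
Unset Printing Implicit Defensive.

Import Order.TTheory GRing.Theory Num.Theory.
Import numFieldNormedType.Exports.

Local Open Scope classical_set_scope.
Local Open Scope ring_scope.

(** Write [K = (n+1)^2 sigma_in^2 / L_in + n^2 sigma_out^2 / L_out]; under the
    calibration this is [mse_bound * L^2 / (4 L_in L_out)].

    Lower bound (Chapman-Robbins, then a limit): moving the records so that the
    observation means move by [s h_i v_i], with [h] the coefficients of the
    difference estimator and [v_i] the noise variances, changes [x_j] by [s K],
    and multiplies the law of the observations by a likelihood ratio [Z] with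
    [E Z = 1] and [E Z^2 = exp (s^2 K)].  Cauchy-Schwarz for [T - x_j] and [Z]
    gives [(s K)^2 <= mse (exp (s^2 K) - 1)], and [s -> 0] gives [K <= mse].

    Attainment: the noise part [V] of the difference estimator satisfies
    [E exp (s V) = exp (s^2 K / 2)], again because [E Z = 1].  Small [s] then
    gives [E V = 0] and [E V^2 <= K], so no covariance is ever computed, and the
    lower bound turns the last inequality into an equality. *)

(** * Measures given by a density *)

Section density_measure.
Local Open Scope ereal_scope.
Context {d} {T : measurableType d} {R : realType}.
Variables (mu : {measure set T -> \bar R}) (h : T -> R).

(** Taking the proofs [mh] and [h0] as arguments lets the measure structure declared below be
    inferred from the term itself. *)
Definition density_measure (mh : measurable_fun [set: T] h)
    (h0 : forall t, (0 <= h t)%R) : set T -> \bar R :=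
  fun A => \int[mu]_(t in A) (h t)%:E.

Variables (mh : measurable_fun [set: T] h) (h0 : forall t, (0 <= h t)%R).
Local Notation nu := (density_measure mh h0).

Let mEh : measurable_fun [set: T] (EFin \o h).
Proof. exact/measurable_EFinP. Qed.

Let nu0 : nu set0 = 0.
Proof. by rewrite /density_measure integral_set0. Qed.

Let nu_ge0 A : 0 <= nu A.
Proof. by apply: integral_ge0 => t _; rewrite lee_fin. Qed.

Let nu_sigma_additive : semi_sigma_additive nu.
Proof.
move=> F mF tF mUF; rewrite /density_measure ge0_integral_bigcup//=.
- by apply: is_cvg_ereal_nneg_natsum_cond => n _ _; exact: nu_ge0.
- exact: measurable_funTS.
- by move=> t _; rewrite lee_fin.
Qed.

HB.instance Definition _ := isMeasure.Build _ _ _ nu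
  nu0 nu_ge0 nu_sigma_additive.

Import HBNNSimple.

(** By linearity it is enough to treat the indicator of a level set, where both sides are the
    integral of [h] over that set. *)
Let integral_density_nnsfun (f : {nnsfun T >-> R}) :
  \int[nu]_t (f t)%:E = \int[mu]_t ((f t)%:E * (h t)%:E).
Proof.
have mf1 r : measurable (f @^-1` [set r]) by exact: measurable_sfunP.
have mi r : measurable_fun [set: T] (fun t => (\1_(f @^-1` [set r]) t)%:E).
  exact/measurable_EFinP/measurable_indic.
under [RHS]eq_integral => t _.
  rewrite fimfunE -fsumEFin// ge0_mule_fsuml; last first.
    by move=> r; exact: nnfun_muleindic_ge0.
  over.
under [LHS]eq_integral do rewrite fimfunE -fsumEFin//.
rewrite !ge0_integral_fsum//=; first last.
- by move=> r t _; exact: nnfun_muleindic_ge0.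
- by move=> r; apply/measurable_EFinP/measurable_funM.
- by move=> r t _; rewrite mule_ge0 ?lee_fin//; exact: nnfun_muleindic_ge0.
- move=> r; apply: emeasurable_funM => //.
  exact/measurable_EFinP/measurable_funM.
apply: eq_fsbigr => r /[!inE] -[t _ <-].
under [LHS]eq_integral do rewrite EFinM.
under [RHS]eq_integral do rewrite ?EFinM -muleA.
rewrite !ge0_integralZl//= ?lee_fin//; first last.
- by move=> u _; rewrite mule_ge0// lee_fin.
- exact: emeasurable_funM.
congr *%E; rewrite integral_indic//= setIT.
rewrite /density_measure integral_mkcond; apply: eq_integral => u _.
by rewrite patchE indicE; case: ifPn; rewrite ?mul1e ?mul0e.
Qed.

Let ge0_integral_density (f : T -> \bar R) :
  measurable_fun [set: T] f -> (forall t, 0 <= f t) ->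
  \int[nu]_t f t = \int[mu]_t (f t * (h t)%:E).
Proof.
move=> mf f0; pose f_ := nnsfun_approx measurableT mf.
have cvg_f t : EFin \o f_ ^~ t @ \oo --> f t by exact: cvg_nnsfun_approx.
have nd_f t : nondecreasing_seq (fun n => (f_ n t)%:E).
  by move=> m n mn; rewrite lee_fin; exact/lefP/nd_nnsfun_approx.
transitivity (limn (fun n => \int[nu]_t (f_ n t)%:E)).
  rewrite -monotone_convergence//.
  - by apply: eq_integral => t _; apply/esym/cvg_lim => //; exact: cvg_f.
  - by move=> n; exact/measurable_EFinP.
  - by move=> n t _; rewrite lee_fin.
under eq_fun do rewrite integral_density_nnsfun.
rewrite -monotone_convergence//.
- apply: eq_integral => t _; apply/cvg_lim => //.
  by apply: cvgeZr => //; exact: cvg_f.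
- by move=> n; apply: emeasurable_funM => //; exact/measurable_EFinP.
- by move=> n t _; rewrite mule_ge0 ?lee_fin.
- by move=> t _ m n mn; rewrite lee_wpmul2r ?lee_fin//; exact: nd_f.
Qed.


(** The integral is the difference of those of the positive and negative parts, and multiplication
    by [h >= 0] commutes with taking these parts. Hence [f] need not be integrable. *)
Lemma integral_density_pushforward {d'} {Y : measurableType d'} (phi : T -> Y)
    (f : Y -> \bar R) :
  measurable_fun [set: T] phi -> measurable_fun [set: Y] f ->
  \int[pushforward nu phi]_y f y = \int[mu]_t (f (phi t) * (h t)%:E).
Proof.
move=> mphi mf.
have mfp : measurable_fun [set: Y] f^\+ by exact: measurable_funepos.
have mfn : measurable_fun [set: Y] f^\- by exact: measurable_funeneg.
rewrite [LHS]integralE !(@ge0_integral_pushforward _ _ _ _ _ phi)//.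
rewrite preimage_setT !ge0_integral_density//; first last.
- by move=> t; rewrite /= funepos_ge0.
- exact: (measurableT_comp mfp).
- by move=> t; rewrite /= funeneg_ge0.
- exact: (measurableT_comp mfn).
rewrite [RHS]integralE; congr (_ - _); apply: eq_integral => t _ /=.
  by rewrite !funeposE /= muleC maxe_pMr ?lee_fin// mule0 muleC.
by rewrite !funenegE /= muleC maxe_pMr ?lee_fin// mule0 muleN muleC.
Qed.

Lemma integral_density (f : T -> \bar R) : measurable_fun [set: T] f ->
  \int[nu]_t f t = \int[mu]_t (f t * (h t)%:E).
Proof. exact: (integral_density_pushforward (@measurable_id _ _ _)). Qed.

End density_measure.

(** * Independence *)

Section coordinates.
Context {R : realType} {a b : nat}.
Local Notation Y := (a.-tuple R * b.-tuple R)%type.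

(** Indexing both blocks by one sum type lets the Gaussian arguments treat them as a single
    family. *)
Definition coord (y : Y) (i : 'I_a + 'I_b) : R :=
  match i with inl l => tnth y.1 l | inr l => tnth y.2 l end.

Lemma measurable_coord i : measurable_fun [set: Y] (coord ^~ i).
Proof.
by case: i => l /=; apply: (measurableT_comp (measurable_tnth l)).
Qed.

Lemma measurable_fun_coordP {d} {T : measurableType d} (f : T -> Y) :
  (forall i, measurable_fun [set: T] (fun t => coord (f t) i)) ->
  measurable_fun [set: T] f.
Proof.
move=> mf; apply/measurable_fun_pairP; split; apply/measurable_fun_tnthP => l.
  exact: (mf (inl l)).
exact: (mf (inr l)).
Qed.

Definition rectangle (A : 'I_a + 'I_b -> set R) : set Y :=
  [set y | forall i, A i (coord y i)].

Lemma measurable_rectangle A : (forall i, measurable (A i)) ->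
  measurable (rectangle A).
Proof.
move=> mA.
rewrite [rectangle A](_ : _ = \big[setI/setT]_i (coord ^~ i @^-1` A i)).
  apply: bigsetI_measurable => i _.
  by rewrite -[X in measurable X]setTI; exact: measurable_coord.
rewrite -bigcap_seq; apply/seteqP; split => y /= Ay i.
  by move=> _; exact: Ay.
by apply: Ay; rewrite /= mem_index_enum.
Qed.

(** Rectangles are stable under intersection and generate the product sigma-algebra, so a finite
    measure is determined by its values on them. *)
Lemma rectangle_measure_unique (m1 m2 : {measure set Y -> \bar R}) :
  (m1 [set: Y] < +oo)%E ->
  (forall A, (forall i, measurable (A i)) ->
    m1 (rectangle A) = m2 (rectangle A)) ->
  forall X, measurable X -> m1 X = m2 X.
Proof.
move=> m1oo m12.
pose G : set (set Y) :=
  [set X | exists2 A, forall i, measurable (A i) & X = rectangle A].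
have GT : G [set: Y].
  by exists (fun=> setT) => //; apply/seteqP; split.
(* Generation by rectangles: the preimage of a Borel set under one coordinate is a rectangle whose
   other sides are the whole line. *)
have mid : @measurable_fun _ _ (g_sigma_algebraType G) Y [set: Y] id.
  apply: measurable_fun_coordP => i _ A mA; rewrite setTI.
  apply: sub_sigma_algebra; exists (fun k => if k == i then A else setT).
    by move=> k; case: ifP.
  apply/seteqP; split => y /=.
    by move=> Ay k; case: eqP => // ->.
  by move/(_ i); rewrite eqxx.
apply: (measure_unique G (fun=> setT)) => //.
- apply/seteqP; split => X.
    by move=> mX; have := mid measurableT _ mX; rewrite setTI preimage_id.
  apply: smallest_sub; first exact: sigma_algebra_measurable.
  by move=> _ [A mA ->]; exact: measurable_rectangle.
- move=> _ _ [A mA ->] [A' mA' ->]; exists (fun i => A i `&` A' i).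
    by move=> i; exact: measurableI.
  apply/seteqP; split => y /=; first by move=> [Ay A'y] i.
  by move=> Ay; split => i; have [] := Ay i.
- by rewrite bigcup_const.
- by move=> _ [A mA ->]; exact: m12.
Qed.

End coordinates.

Section independence_expectation.
Context {d} {Om : measurableType d} {R : realType} (P : probability Om R).
Context {I : finType} (w : I -> {RV P >-> R}).
Hypothesis indep : mutually_independent w.

(* Induction on the set [S] of indices where [f i] is not an indicator: for
   [k \in S], the formula with [f k] replaced by indicators says that two
   measures on [R] agree, and [f k] is integrated against both. *)
Let expectation_prod_rec (S : {set I}) (f : I -> R -> R) (m : I -> R) :
  (forall i, measurable_fun [set: R] (f i)) ->
  (forall i u, 0 <= f i u) ->
  (forall i, \int[P]_o (f i (w i o))%:E = (m i)%:E)%E ->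
  (forall i, i \notin S -> exists2 A : set R, measurable A & f i = \1_A) ->
  (\int[P]_o (\prod_i f i (w i o))%:E = (\prod_i m i)%:E)%E.
Proof.
have [n] := ubnP #|S|; elim: n => // n IH in S f m * => Sn mf f0 fm fS.
have prodEFin (Q : pred I) (r : I -> R) :
    (\prod_(i | Q i) r i)%:E = (\prod_(i | Q i) (r i)%:E)%E.
  by rewrite (big_morph EFin EFinM (erefl _)).
(* When [S] is empty all factors are indicators; their product is the indicator of an intersection,
   and independence applies to the full index set. *)
have [S0|[k kS]] := set_0Vmem S.
  have /choice[A fA] : forall i, exists A : set R, measurable A /\ f i = \1_A.
    by move=> i; have [|A mA fA] := fS i; [rewrite S0 inE|exists A].
  have mA i : measurable (A i) by have [] := fA i.
  have fE i o : f i (w i o) = \1_(w i @^-1` A i) o by have [_ ->] := fA i.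
  have mwA i : measurable (w i @^-1` A i).
    by rewrite -[X in measurable X]setTI; exact: measurable_funP.
  have PA i : P (w i @^-1` A i) = (m i)%:E.
    by rewrite -fm; under eq_integral do rewrite fE; rewrite integral_indic// setIT.
  have indepA : P (\bigcap_(i in [set` [set: I]%SET]) (w i @^-1` A i)) =
      (\prod_i m i)%:E.
    rewrite indep// prodEFin; apply: eq_big => [i|i _]; first by rewrite inE.
    exact: PA.
  rewrite -indepA -[X in P X]setIT -integral_indic//; last first.
    by apply: fin_bigcap_measurable => //; exact: finite_finset.
  apply: eq_integral => o _; congr EFin; under eq_bigr do rewrite fE indicE.
  rewrite indicE; have [oA|] := boolP (o \in _).
    rewrite big1// => i _; move/set_mem : oA => /(_ i); rewrite /= inE => /(_ isT) oA.
    by rewrite mem_set.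
  rewrite notin_setE => /existsNP[i /not_implyP[_ oA]].
  by rewrite (bigD1 i)//= memNset// mul0r.
(* The factors other than [k] form the density [h], their means the constant density [c]; the two
   measures to compare are the images under [w k]. *)
pose h o := \prod_(i | i != k) f i (w i o).
have mwf i : measurable_fun [set: Om] (fun o => f i (w i o)).
  exact: measurableT_comp.
have mh : measurable_fun [set: Om] h.
  by rewrite /h; under eq_fun do rewrite -big_filter; exact: measurable_prod.
have h0 o : 0 <= h o by exact: prodr_ge0.
have m0 i : 0 <= m i.
  by rewrite -lee_fin -fm; apply: integral_ge0 => o _; rewrite lee_fin.
pose c := \prod_(i | i != k) m i.
have c0 : 0 <= c by exact: prodr_ge0.
have mc : measurable_fun [set: Om] (cst c) by [].
rewrite (bigD1 k)//= -/c.
transitivity (\int[pushforward (density_measure P mh h0) (w k)]_u (f k u)%:E)%E.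
  rewrite integral_density_pushforward//; last exact/measurable_EFinP.
  by apply: eq_integral => o _; rewrite (bigD1 k)//= EFinM.
transitivity (\int[pushforward (density_measure P mc (fun=> c0)) (w k)]_u
    (f k u)%:E)%E.
  apply: eq_measure_integral => A mA _.
  have mwA : measurable (w k @^-1` A).
    by rewrite -[X in measurable X]setTI; exact: measurable_funP.
  rewrite /pushforward /density_measure.
  transitivity (c%:E * P (w k @^-1` A))%E; last by rewrite -integral_cst.
  have Poo : (P (w k @^-1` A) \is a fin_num)%E by exact: fin_num_measure.
  pose f' i := if i == k then \1_A else f i.
  pose m' i := if i == k then fine (P (w k @^-1` A)) else m i.
  have : (\int[P]_o (\prod_i f' i (w i o))%:E = (\prod_i m' i)%:E)%E.
    apply: (IH (S :\ k)) => [||i u|i|i].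
    - by move: Sn; rewrite (cardsD1 k) kS.
    - by move=> i; rewrite /f'; case: ifP => // _; exact: measurable_indic.
    - by rewrite /f'; case: ifP => // _; rewrite indicE.
    - rewrite /f' /m'; case: eqP => [->|_]; last exact: fm.
      by rewrite fineK// -[X in _ = P X]setIT -integral_indic.
    - rewrite !inE negb_and negbK /f'; case: eqP => [_ _|_ /= iS]; last exact: fS.
      by exists A.
  rewrite (bigD1 k)//= {1}/m' eqxx EFinM fineK// muleC.
  rewrite (_ : \prod_(i | i != k) m' i = c); last first.
    by apply: eq_bigr => i /negPf ik; rewrite /m' ik.
  move=> <-; rewrite [LHS]integral_mkcond; apply: eq_integral => o _.
  rewrite (bigD1 k)//= {1}/f' eqxx.
  rewrite (_ : \prod_(i | i != k) f' i (w i o) = h o); last first.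
    by apply: eq_bigr => i /negPf ik; rewrite /f' ik.
  rewrite patchE indicE (_ : (o \in w k @^-1` A) = (w k o \in A)).
    by case: ifP; rewrite ?mul1r ?mul0r.
  by apply/idP/idP; rewrite !inE.
rewrite integral_density_pushforward//; last exact/measurable_EFinP.
rewrite EFinM -fm -ge0_integralZr//.
- exact/measurable_EFinP.
- by move=> o _; rewrite lee_fin.
Qed.

Lemma expectation_prod (f : I -> R -> R) (m : I -> R) :
  (forall i, measurable_fun [set: R] (f i)) ->
  (forall i u, 0 <= f i u) ->
  (forall i, \int[P]_o (f i (w i o))%:E = (m i)%:E)%E ->
  (\int[P]_o (\prod_i f i (w i o))%:E = (\prod_i m i)%:E)%E.
Proof.
move=> mf f0 fm; apply: (@expectation_prod_rec [set: I]%SET) => // i.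
by rewrite inE.
Qed.

End independence_expectation.

(** * Gaussian shifts *)

(** Lebesgue measure is determined by half-open intervals, whose length a translation preserves. *)
Lemma lebesgue_measure_shift {R : realType} (c : R) (A : set R) :
  measurable A ->
  pushforward lebesgue_measure ((fun u : R => u + c) : _ -> measurableTypeR R) A
  = lebesgue_measure A.
Proof.
have ms : measurable_fun [set: R] (fun u : R => u + c).
  exact: measurable_funD.
move=> mA; apply/esym/lebesgue_measure_unique => //= _ [[x y]] _ <-.
rewrite /pushforward.
have -> : (fun u : R => u + c) @^-1` `]x, y] = `](x - c), (y - c)]%classic.
  by apply/seteqP; split => u /=; rewrite !in_itv/= ltrBlDr lerBrDr.
rewrite !lebesgue_measure_itv/= !lte_fin ltrD2r.
by case: ifP => // _; rewrite -!EFinB; congr EFin; ring.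
Qed.

Lemma ge0_integral_shift {R : realType} (c : R) (f : R -> \bar R) :
  measurable_fun [set: R] f -> (forall u, 0 <= f u)%E ->
  (\int[lebesgue_measure]_u f (u + c)%R = \int[lebesgue_measure]_u f u)%E.
Proof.
move=> mf f0.
have ms : measurable_fun [set: R] (fun u : R => u + c).
  exact: measurable_funD.
transitivity (\int[pushforward lebesgue_measure
    ((fun u : R => u + c)%R : _ -> measurableTypeR R)]_u f u)%E.
  by rewrite ge0_integral_pushforward.
by apply: eq_measure_integral => //= A mA _; exact: lebesgue_measure_shift.
Qed.

(** Density at [u] of the normal law with mean [c] and variance [v] relative to the centered one. *)
Definition gaussian_ratio {R : realType} (v c u : R) : R :=
  expR (c * u / v - c ^+ 2 / (2 * v)).

Section gaussian_shift.
Context {d} {Om : measurableType d} {R : realType} (P : probability Om R).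

Lemma ge0_expectation_gaussian (v : R) (X : {RV P >-> R}) (g : R -> R) :
  centered_gaussian v X -> measurable_fun [set: R] g ->
  (forall u, 0 <= g u) ->
  (\int[P]_o (g (X o))%:E =
   \int[lebesgue_measure]_u (g u * normal_pdf 0 (Num.sqrt v) u)%:E)%E.
Proof.
move=> gX mg g0; have mEg : measurable_fun [set: R] (EFin \o g).
  exact/measurable_EFinP.
(* Lebesgue measure lives on [measurableTypeR R], whose sigma-algebra is
   convertible to that of [R] but carries another display. *)
pose X' : Om -> measurableTypeR R := X.
have mX : measurable_fun [set: Om] X by exact: measurable_funP.
have mX' : measurable_fun [set: Om] X' by move=> mT A mA; exact: mX.
transitivity (\int[pushforward P X']_u (g u)%:E)%E.
  by rewrite ge0_integral_pushforward// => u _; rewrite lee_fin.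
pose s := Num.sqrt v.
transitivity (\int[density_measure lebesgue_measure
    (measurable_normal_pdf 0 s) (normal_pdf_ge0 0 s)]_u (g u)%:E)%E.
  by apply: eq_measure_integral => //= A mA _; exact: gX.
by rewrite integral_density.
Qed.

Lemma gaussian_ratio_pdf (v c u : R) : 0 < v ->
  gaussian_ratio v c u * normal_pdf 0 (Num.sqrt v) u =
  normal_pdf 0 (Num.sqrt v) (u - c).
Proof.
move=> v0; have s0 : Num.sqrt v != 0 by rewrite gt_eqF ?sqrtr_gt0.
rewrite !normal_pdfE// mulrCA /normal_fun /gaussian_ratio -expRD.
congr (_ * expR _); rewrite sqr_sqrtr ?ltW// !subr0.
by field; rewrite gt_eqF.
Qed.

Lemma measurable_gaussian_ratio (v c : R) :
  measurable_fun [set: R] (gaussian_ratio v c).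
Proof.
apply: measurableT_comp => //; apply: measurable_funB => //.
by apply: measurable_funM => //; exact: measurable_funM.
Qed.

(** One-dimensional Cameron-Martin formula: reweighting by the ratio turns the centered density into
    its translate by [c]. *)
Lemma gaussian_shift (v c : R) (X : {RV P >-> R}) (A : set R) :
  0 < v -> centered_gaussian v X -> measurable A ->
  (\int[P]_o (\1_A (X o) * gaussian_ratio v c (X o))%:E =
   P [set o | A (X o + c)%R])%E.
Proof.
move=> v0 gX mA.
have mA' : measurable [set u | A (u + c)].
  rewrite -[X in measurable X]setTI.
  have ms : measurable_fun [set: R] (fun u : R => u + c).
    exact: measurable_funD.
  exact: (ms measurableT _ mA).
have mXA : measurable [set o | A (X o + c)].
  by rewrite -[X in measurable X]setTI; exact: (measurable_funPT X measurableT _ mA').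
transitivity (\int[P]_o (\1_[set u | A (u + c)] (X o))%:E)%E; last first.
  by rewrite -[X in P X]setIT -integral_indic.
rewrite (ge0_expectation_gaussian (g := fun u => \1_A u * gaussian_ratio v c u) gX)//.
- rewrite (ge0_expectation_gaussian gX)//.
  (* The substitution [u + c] brings the translated density back to the centered one and moves the
     shift into the indicator. *)
  rewrite -[LHS](@ge0_integral_shift _ c)//; first last.
  + by move=> u; rewrite lee_fin !mulr_ge0 ?expR_ge0 ?normal_pdf_ge0.
  + apply/measurable_EFinP/measurable_funM; last exact: measurable_normal_pdf.
    by apply: measurable_funM => //; exact: measurable_gaussian_ratio.
  apply: eq_integral => u _; rewrite -mulrA gaussian_ratio_pdf// addrK.
  rewrite !indicE (_ : (u + c \in A) = (u \in [set u | A (u + c)]))//.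
- by apply: measurable_funM => //; exact: measurable_gaussian_ratio.
- by move=> u; rewrite mulr_ge0 ?expR_ge0.
Qed.

End gaussian_shift.

(** * Change of measure for the whole vector of observations *)

Section gaussian_observations.
Context {d} {Om : measurableType d} {R : realType} (P : probability Om R).
Context {a b : nat} (w : 'I_a + 'I_b -> {RV P >-> R}) (v : 'I_a + 'I_b -> R).
Hypothesis v_gt0 : forall i, 0 < v i.
Hypothesis gaussian_w : forall i, centered_gaussian (v i) (w i).
Hypothesis indep : mutually_independent w.
Implicit Types q c : 'I_a + 'I_b -> R.
Local Notation Y := (a.-tuple R * b.-tuple R)%type.

(** Free means [q] allow shifts to be written directly; [releases] is the case where [q] consists of
    the query values. *)
Definition observation q (o : Om) : Y :=
  ([tuple q (inl l) + w (inl l) o | l < a],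
   [tuple q (inr l) + w (inr l) o | l < b]).

Lemma coord_observation q o i : coord (observation q o) i = q i + w i o.
Proof. by case: i => l; rewrite /coord/= tnth_mktuple. Qed.

Lemma measurable_observation q : measurable_fun [set: Om] (observation q).
Proof.
apply: measurable_fun_coordP => i; under eq_fun do rewrite coord_observation.
exact: measurable_funD.
Qed.

(** Density of the law of the noise shifted by [c] relative to the unshifted law, evaluated at the
    noise. *)
Definition likelihood_ratio c (o : Om) : R :=
  \prod_i gaussian_ratio (v i) (c i) (w i o).

Lemma likelihood_ratioE c o :
  likelihood_ratio c o =
  expR (\sum_i c i * w i o / v i - (\sum_i c i ^+ 2 / v i) / 2).
Proof.
rewrite /likelihood_ratio -expR_sum sumrB mulr_suml.
congr (expR (_ - _)); apply: eq_bigr => i _.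
by rewrite invfM mulrA mulrAC.
Qed.

Lemma likelihood_ratio_ge0 c o : 0 <= likelihood_ratio c o.
Proof. by rewrite likelihood_ratioE expR_ge0. Qed.

(** Squaring doubles the shift up to a constant factor, so the second moment follows from the ratio
    having mean 1. *)
Lemma likelihood_ratio_sqr c o :
  likelihood_ratio c o ^+ 2 =
  expR (\sum_i c i ^+ 2 / v i) * likelihood_ratio (fun i => 2 * c i) o.
Proof.
rewrite !likelihood_ratioE -expRM_natl -expRD; congr expR.
have -> : \sum_i 2 * c i * w i o / v i = 2 * \sum_i c i * w i o / v i.
  by rewrite mulr_sumr; apply: eq_bigr => i _; rewrite !mulrA.
have -> : \sum_i (2 * c i) ^+ 2 / v i = 4 * \sum_i c i ^+ 2 / v i.
  by rewrite mulr_sumr; apply: eq_bigr => i _; rewrite exprMn -natrX mulrA.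
by field.
Qed.

Lemma measurable_likelihood_ratio c :
  measurable_fun [set: Om] (likelihood_ratio c).
Proof.
apply: measurable_prod => i _.
by apply: (measurableT_comp (measurable_gaussian_ratio _ _)).
Qed.

Let m1c : measurable_fun [set: Om] (cst 1 : Om -> R). Proof. by []. Qed.

Let density1 (X : set Om) : measurable X ->
  density_measure P m1c (fun=> ler01) X = P X.
Proof. by move=> mX; rewrite -[RHS]mul1e -integral_cst. Qed.

(* [P] is written as its density-1 version so that both sides of
   [integral_observation_shift] go through [integral_density_pushforward],
   which has no integrability hypothesis. *)
Lemma law_observation_shift q c (X : set Y) : measurable X ->
  pushforward (density_measure P m1c (fun=> ler01)) (observation (q \+ c)) X =
  pushforward (density_measure P (measurable_likelihood_ratio c)
    (likelihood_ratio_ge0 c)) (observation q) X.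
Proof.
have mo := measurable_observation.
move: X; apply: rectangle_measure_unique => //=.
  by rewrite /pushforward preimage_setT density1// probability_setT ltry.
move=> A mA.
(* [A' i] is the side [A i] read on the noise alone; [D i] also absorbs the shift [c i]. *)
pose A' i : set R := [set u | A i (q i + u)].
have mA' i : measurable (A' i).
  have ms : measurable_fun [set: R] (fun u : R => q i + u).
    exact: measurable_funD.
  by rewrite -[X in measurable X]setTI; exact: (ms measurableT _ (mA i)).
pose D i : set R := [set u | A' i (u + c i)].
have mD i : measurable (D i).
  have ms : measurable_fun [set: R] (fun u : R => u + c i).
    exact: measurable_funD.
  by rewrite -[X in measurable X]setTI; exact: (ms measurableT _ (mA' i)).
pose p i := fine (P (w i @^-1` D i)).
have pE i : P (w i @^-1` D i) = (p i)%:E.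
  by rewrite fineK// fin_num_measure//; exact: (measurable_sfunP _ (mD i)).
(* Both laws give a rectangle the product of the probabilities of the [D i]: one by independence of
   events, the other by [expectation_prod] and [gaussian_shift]. *)
transitivity ((\prod_i p i)%:E).
  rewrite /pushforward density1; last first.
    rewrite -[X in measurable X]setTI; apply: mo => //.
    exact: measurable_rectangle.
  rewrite (_ : _ @^-1` _ = \bigcap_(i in [set` [set: 'I_a + 'I_b]%SET]) (w i @^-1` D i)).
    rewrite indep// (big_morph EFin EFinM (erefl _)).
    by apply: eq_big => [i|i _]; rewrite ?inE.
  apply/seteqP; split => o oA i; last first.
    by have := oA i; rewrite /= inE coord_observation /D /A' /= addrAC addrA => /(_ isT).
  by move=> _; have := oA i; rewrite /= coord_observation /D /A' /= -addrA [c i + _]addrC.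
rewrite /pushforward /density_measure integral_mkcond.
rewrite -(expectation_prod indep
  (f := fun i u => \1_(A' i) u * gaussian_ratio (v i) (c i) u)).
- apply: eq_integral => o _; rewrite patchE big_split/=.
  have [oA|oA] := boolP (o \in _).
    rewrite big1 ?mul1r// => i _; rewrite indicE mem_set// /A' /=.
    by move/set_mem : oA => /(_ i); rewrite coord_observation.
  have /existsNP[i oAi] : ~ forall i, A i (coord (observation q o) i).
    by move=> oA'; move/negP : oA; apply; rewrite inE.
  rewrite (bigD1 i)//= indicE memNset ?mul0r//.
  by rewrite /A' /= -coord_observation.
- move=> i; apply: measurable_funM; first exact: measurable_indic.
  exact: measurable_gaussian_ratio.
- by move=> i u; rewrite mulr_ge0 ?expR_ge0.
- by move=> i; rewrite gaussian_shift//; exact: pE.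
Qed.

Lemma integral_observation_shift q c (f : Y -> \bar R) :
  measurable_fun [set: Y] f ->
  (\int[P]_o f (observation (q \+ c)%R o) =
   \int[P]_o (f (observation q o) * (likelihood_ratio c o)%:E))%E.
Proof.
have mo := measurable_observation.
move=> mf.
transitivity (\int[P]_o (f (observation (q \+ c)%R o) * (cst 1 o)%:E))%E.
  by apply: eq_integral => o _; rewrite mule1.
rewrite -(integral_density_pushforward _ m1c (fun=> ler01))//.
rewrite -(integral_density_pushforward _ (measurable_likelihood_ratio c)
  (likelihood_ratio_ge0 c))//.
by apply: eq_measure_integral => X mX _; exact: law_observation_shift.
Qed.

(** This is the change of measure for the constant function 1. *)
Lemma expectation_likelihood_ratio c :
  (\int[P]_o (likelihood_ratio c o)%:E = 1)%E.
Proof.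
rewrite -[RHS](probability_setT P) -[RHS]mul1e -integral_cst//.
rewrite [RHS](integral_observation_shift (fun=> 0) c (measurable_cst 1%E)).
by apply: eq_integral => o _; rewrite mul1e.
Qed.

Lemma expectation_likelihood_ratio_sqr c :
  (\int[P]_o (likelihood_ratio c o ^+ 2)%:E =
   (expR (\sum_i c i ^+ 2 / v i))%:E)%E.
Proof.
under eq_integral do rewrite likelihood_ratio_sqr EFinM.
have mZ := measurable_likelihood_ratio (fun i => 2 * c i).
rewrite ge0_integralZl//= ?lee_fin ?expR_ge0//.
- by rewrite expectation_likelihood_ratio mule1.
- exact/measurable_EFinP.
- by move=> o _; rewrite lee_fin likelihood_ratio_ge0.
Qed.

End gaussian_observations.

(** * Second-moment inequalities *)

Section chapman_robbins.
Context {d} {Om : measurableType d} {R : realType} (P : probability Om R).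

Lemma Lfun2_sqr (f : Om -> R) : measurable_fun [set: Om] f ->
  (\int[P]_o (f o ^+ 2)%:E < +oo)%E -> f \in Lfun P 2%:E.
Proof.
move=> mf foo; rewrite inE; apply/andP; split; rewrite inE//=.
rewrite /finite_norm unlock/= poweR_lty//.
rewrite (eq_integral (fun o => (f o ^+ 2)%:E))// => o _.
by rewrite /= powR_mulrn// -normrX ger0_norm ?sqr_ge0.
Qed.

(** With [X] centered and [Z] of mean 1, the covariance is [t] and the variances are [V] and
    [C - 1]; Cauchy-Schwarz applies. *)
Lemma covariance_sqr_le (X Z : Om -> R) (t V C : R) :
  measurable_fun [set: Om] X -> measurable_fun [set: Om] Z -> 0 <= t ->
  (\int[P]_o (X o)%:E = 0)%E -> (\int[P]_o (Z o)%:E = 1)%E ->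
  (\int[P]_o (X o * Z o)%:E = t%:E)%E ->
  (\int[P]_o (X o ^+ 2)%:E = V%:E)%E ->
  (\int[P]_o (Z o ^+ 2)%:E = C%:E)%E ->
  t ^+ 2 <= V * (C - 1).
Proof.
move=> mX mZ t0 EX EZ EXZ EX2 EZ2.
have X2 : X \in Lfun P 2%:E by apply: Lfun2_sqr => //; rewrite EX2 ltry.
have Z2 : Z \in Lfun P 2%:E by apply: Lfun2_sqr => //; rewrite EZ2 ltry.
have Pfin : P setT \is a fin_num := fin_num_measure P _ measurableT.
have VX : 'V_P[X] = V%:E.
  rewrite varianceE// unlock EX expe2 mule0 sube0; exact: EX2.
have VZ : 'V_P[Z] = (C - 1)%:E.
  by rewrite varianceE// unlock EZ expe2 mule1 EFinB; congr (_ - _)%E; exact: EZ2.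
have cXZ : covariance P X Z = t%:E.
  have X1 := Lfun_subset12 Pfin X2; have Z1 := Lfun_subset12 Pfin Z2.
  rewrite covarianceE//; last exact: Lfun2_mul_Lfun1.
  rewrite unlock EX mul0e sube0.
  exact: EXZ.
have := covariance_le X2 Z2; rewrite cXZ VX VZ /= -EFinM lee_fin => tle.
have V0 : 0 <= V by rewrite -lee_fin -VX variance_ge0.
have C0 : 0 <= C - 1 by rewrite -lee_fin -VZ variance_ge0.
have := lerXn2r 2 _ _ tle.
by rewrite exprMn !sqr_sqrtr// => ->//; rewrite nnegrE// mulr_ge0.
Qed.

End chapman_robbins.

(** * Elementary estimates for small parameters *)

Section small_parameter.
Context {R : realType}.

(** Multiply [1 - x <= expR (- x)] by [expR x]. For [x < 1] this bounds [expR x - 1] by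
    [x / (1 - x)]. *)
Lemma expR_sub1_le (x : R) : (1 - x) * (expR x - 1) <= x.
Proof.
have : (1 - x) * expR x <= 1.
  rewrite -[leRHS](expR0 R) -(subrr (- x)) opprK expRD ler_pM2r ?expR_gt0//.
  exact: expR_ge1Dx.
by lra.
Qed.

(** Stands in for the limit as [s] tends to 0: the error [s * (A * C)] drops below any [r > 0]. *)
Lemma le_small (A B C e : R) : 0 < e ->
  (forall s, 0 < s -> s < e -> A * (1 - s * C) <= B) -> A <= B.
Proof.
move=> e0 h; apply/ler_addgt0Pr => r r0.
(* Adding 1 keeps the divisor positive when [A * C = 0]. *)
pose D := `|A * C| + 1.
have D0 : 0 < D by rewrite ltr_wpDl.
pose s := Num.min (e / 2) (r / D).
have s0 : 0 < s by rewrite lt_min !divr_gt0.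
have se : s < e by rewrite gt_min; apply/orP; left; lra.
have := h _ s0 se.
have : s * D <= r by rewrite -ler_pdivlMr// ge_min lexx orbT.
have : s * (A * C) <= s * `|A * C| by rewrite ler_pM2l// ler_norm.
by rewrite /D; lra.
Qed.

(** For [u = 2 * x] the right-hand side is the square of [expR x - expR (- x)], which is at least
    [2 * x] when [x >= 0]. Evenness covers negative [u]. *)
Lemma sqr_le_expR (u : R) : u ^+ 2 <= expR u + expR (- u) - 2.
Proof.
pose g (x : R) := expR x - expR (- x) - 2 * x.
have dg (x : R) : is_derive x 1 g (expR x + expR (- x) - 2).
  rewrite /g; apply: is_derive_eq; rewrite /GRing.scale/=; ring.
have g0 (x : R) : 0 <= x -> 0 <= g x.
  move=> x0; have -> : 0 = g 0 by rewrite /g oppr0 expR0; ring.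
  apply: (@ger0_derive1_ndecry _ g 0) => //.
  - move=> y _; rewrite derive1E; have [_ ->] := dg y.
    (* The derivative of [g] at [y] is exactly this square. *)
    have := sqr_ge0 (expR (y / 2) - expR (- (y / 2))).
    have e1 : expR y = expR (y / 2) ^+ 2 by rewrite -expRM_natl mulrC divfK.
    have e2 : expR (- y) = expR (- (y / 2)) ^+ 2.
      by rewrite -expRM_natl mulrN mulrC divfK.
    have := expRxMexpNx_1 (y / 2).
    by rewrite e1 e2 sqrrB -mulr_natr => ->; lra.
  - apply: continuous_subspaceT => y; have [dgy _] := dg y.
    exact/differentiable_continuous/derivable1_diffP.
have sq (x : R) : 0 <= x -> (2 * x) ^+ 2 <= expR (2 * x) + expR (- (2 * x)) - 2.
  move=> x0; have := g0 _ x0; rewrite /g subr_ge0 => le.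
  have := lerXn2r 2 _ _ le.
  have e1 : expR (2 * x) = expR x ^+ 2 by rewrite expRM_natl.
  have e2 : expR (- (2 * x)) = expR (- x) ^+ 2 by rewrite -mulrN expRM_natl.
  have e3 : expR x * expR (- x) = 1 by exact: expRxMexpNx_1.
  rewrite e1 e2 => /(_ _ _)/le_trans; apply.
  - by rewrite nnegrE mulr_ge0.
  - by rewrite nnegrE (le_trans _ le)// mulr_ge0.
  - by rewrite sqrrB -mulr_natr e3; lra.
have half (x : R) : 2 * (x / 2) = x by field.
have [u0|u0] := leP 0 u.
  by have := sq (u / 2); rewrite half; apply; lra.
have := sq (- u / 2); rewrite half sqrrN opprK [expR (- u) + _]addrC.
by apply; lra.
Qed.

End small_parameter.

(** * Moments from a Gaussian moment generating function *)

Section subgaussian.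
Context {d} {Om : measurableType d} {R : realType} (P : probability Om R).
Variables (X : Om -> R) (K : R).
Hypothesis mX : measurable_fun [set: Om] X.
Hypothesis K_ge0 : 0 <= K.
Hypothesis mgfX : forall s,
  (\int[P]_o (expR (s * X o))%:E = (expR (s ^+ 2 * (K / 2)))%:E)%E.

Let mexp s : measurable_fun [set: Om] (fun o => expR (s * X o)).
Proof. by apply: measurableT_comp => //; exact: measurable_funM. Qed.

Let mX2 : measurable_fun [set: Om] (fun o => X o ^+ 2).
Proof. exact: measurable_funX. Qed.

Let le_int (f g : Om -> R) :
  measurable_fun [set: Om] f -> measurable_fun [set: Om] g ->
  (forall o, 0 <= f o) -> (forall o, f o <= g o) ->
  (\int[P]_o (f o)%:E <= \int[P]_o (g o)%:E)%E.
Proof.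
move=> mf mg f0 fg.
have mEf : measurable_fun [set: Om] (EFin \o f) by exact/measurable_EFinP.
have mEg : measurable_fun [set: Om] (EFin \o g) by exact/measurable_EFinP.
by apply: ge0_le_integral => // o _; rewrite lee_fin.
Qed.

Let ge0_int_add (f g : Om -> R) :
  measurable_fun [set: Om] f -> measurable_fun [set: Om] g ->
  (forall o, 0 <= f o) -> (forall o, 0 <= g o) ->
  (\int[P]_o (f o + g o)%:E =
   \int[P]_o (f o)%:E + \int[P]_o (g o)%:E)%E.
Proof.
move=> mf mg f0 g0.
have mEf : measurable_fun [set: Om] (EFin \o f) by exact/measurable_EFinP.
have mEg : measurable_fun [set: Om] (EFin \o g) by exact/measurable_EFinP.
under eq_integral do rewrite EFinD.
by rewrite ge0_integralD// => o _; rewrite lee_fin.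
Qed.

(** Integrate [sqr_le_expR] at [s * X o]; both exponentials have the same mean. *)
Let second_moment_exp s :
  (\int[P]_o (s ^+ 2 * X o ^+ 2 + 2)%:E <= (2 * expR (s ^+ 2 * (K / 2)))%:E)%E.
Proof.
have -> : (2 * expR (s ^+ 2 * (K / 2)))%:E =
    (\int[P]_o (expR (s * X o) + expR (- s * X o))%:E)%E.
  rewrite ge0_int_add// !mgfX sqrrN -?EFinD//.
  by congr EFin; ring.
apply: le_int => [|||o].
- by apply: measurable_funD => //; exact: measurable_funM.
- exact: measurable_funD.
- by move=> o; rewrite addr_ge0// mulr_ge0 ?sqr_ge0.
- rewrite -exprMn mulNr.
  by have := sqr_le_expR (s * X o); lra.
Qed.

Let second_moment_lty : (\int[P]_o (X o ^+ 2)%:E < +oo)%E.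
Proof.
apply: (@le_lt_trans _ _ (2 * expR (1 ^+ 2 * (K / 2)))%:E); last exact: ltry.
apply: le_trans (second_moment_exp 1); apply: le_int => // [|o|o].
- by apply: measurable_funD => //; exact: measurable_funM.
- exact: sqr_ge0.
- by rewrite expr1n mul1r; lra.
Qed.

(** With [r = s ^+ 2], [second_moment_exp] and [expR_sub1_le] give [(1 - r * (K / 2)) * M <= K];
    then [r] tends to 0. *)
Lemma subgaussian_second_moment : (\int[P]_o (X o ^+ 2)%:E <= K%:E)%E.
Proof.
pose M := fine (\int[P]_o (X o ^+ 2)%:E)%E.
have ME : (\int[P]_o (X o ^+ 2)%:E = M%:E)%E.
  rewrite fineK// ge0_fin_numE//; apply: integral_ge0 => o _.
  by rewrite lee_fin sqr_ge0.
rewrite ME lee_fin.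
(* The range makes [r * (K / 2) < 1]; adding 1 covers [K = 0]. *)
apply: (@le_small _ _ _ (K / 2) (K + 1)^-1); first by rewrite invr_gt0 ltr_wpDl.
move=> r r0; rewrite -[_^-1]mul1r ltr_pdivlMr ?ltr_wpDl// => rK.
have rK0 : 0 <= r * K by rewrite mulr_ge0// ltW.
pose s := Num.sqrt r.
have sr : s ^+ 2 = r by rewrite sqr_sqrtr// ltW.
have := second_moment_exp s.
rewrite ge0_int_add//; last 2 first.
- exact: measurable_funM.
- by move=> o; rewrite mulr_ge0 ?sqr_ge0.
have mEX2 : measurable_fun [set: Om] (EFin \o (fun o => X o ^+ 2)).
  exact/measurable_EFinP.
under eq_integral do rewrite EFinM.
rewrite ge0_integralZl//= ?lee_fin ?sqr_ge0//; last first.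
  by move=> o _; rewrite lee_fin sqr_ge0.
rewrite ME (_ : (\int[P]_ _ 2%:E = 2%:E)%E); last first.
  by rewrite -[RHS]mule1 -(probability_setT P) -integral_cst.
rewrite -EFinM -EFinD lee_fin sr => h.
have rK1 : r * (K / 2) < 1 by lra.
have := expR_sub1_le (r * (K / 2)).
move: h; set E := expR _ => h h'.
have : (1 - r * (K / 2)) * (r * M) <= (1 - r * (K / 2)) * (2 * (E - 1)).
  by rewrite ler_pM2l; lra.
rewrite -(ler_pM2l r0); nra.
Qed.

Lemma subgaussian_integrable : P.-integrable [set: Om] (EFin \o X).
Proof.
apply/Lfun1_integrable/Lfun_subset12; last exact: Lfun2_sqr.
exact: (fin_num_measure P _ measurableT).
Qed.

(** Integrating [1 + y <= expR y] gives [1 + s * m <= expR (s ^+ 2 * (K / 2))]. The right-hand side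
    exceeds 1 only to second order in [s], so small [s] of either sign force [m = 0]. *)
Lemma subgaussian_mean : (\int[P]_o (X o)%:E = 0)%E.
Proof.
have iX := subgaussian_integrable.
pose m := fine (\int[P]_o (X o)%:E)%E.
have mE : (\int[P]_o (X o)%:E = m%:E)%E.
  by rewrite fineK//; exact: integrable_fin_num iX.
have i1 : P.-integrable [set: Om] (fun=> 1%:E).
  exact: finite_measure_integrable_cst.
have iZ s : P.-integrable [set: Om] (fun o => s%:E * (X o)%:E)%E.
  exact: integrableZl.
have ms s : 1 + s * m <= expR (s ^+ 2 * (K / 2)).
  rewrite -lee_fin -mgfX.
  have -> : (1 + s * m)%:E = (\int[P]_o (1 + s * X o)%:E)%E.
    under eq_integral do rewrite EFinD EFinM.
    rewrite (integralD measurableT i1 (iZ s)) integralZl// mE EFinD EFinM.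
    by congr (_ + _)%E; rewrite -[LHS]mule1 -(probability_setT P) -integral_cst.
  apply: le_integral => //=.
  - under eq_fun do rewrite EFinD EFinM.
    by apply: integrableD => //; exact: iZ.
  - apply/integrableP; split; first exact/measurable_EFinP.
    under eq_integral do rewrite gee0_abs ?lee_fin ?expR_ge0//.
    by rewrite mgfX ltry.
  - by move=> o _; rewrite lee_fin expR_ge1Dx.
have m_le0 (t : R) :
    (forall s, 0 < s -> s * t <= expR (s ^+ 2 * (K / 2)) - 1) -> t <= 0.
  move=> h; rewrite leNgt; apply/negP => t0; suff : t <= 0 by rewrite leNgt t0.
  (* The constant makes the left-hand side [t - s * K * t / 2 - s * K / 2], which [h2] bounds by 0
     once [s ^+ 2] is replaced by the larger [s]. *)
  apply: (@le_small _ _ _ (K / 2 + K / (2 * t)) (K + 1)^-1).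
    by rewrite invr_gt0 ltr_wpDl.
  move=> s s0; rewrite -[_^-1]mul1r ltr_pdivlMr ?ltr_wpDl// => sK.
  have sK0 : 0 <= s * K by rewrite mulr_ge0// ltW.
  have := h s s0; have := expR_sub1_le (s ^+ 2 * (K / 2)).
  set E := expR _ => E1 hE.
  have s1 : s < 1 by lra.
  have x1 : s ^+ 2 * (K / 2) < 1 by rewrite expr2; nra.
  have : (1 - s ^+ 2 * (K / 2)) * (s * t) <= s ^+ 2 * (K / 2).
    by apply: le_trans E1; rewrite ler_pM2l//; lra.
  rewrite {1}expr2 => h1.
  have h2 : (1 - s ^+ 2 * (K / 2)) * t <= s * (K / 2).
    by rewrite -(ler_pM2l s0); lra.
  have h3 : t * (s * K * s) <= t * (s * K * 1).
    by rewrite !ler_wpM2l// ltW.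
  rewrite (_ : t * _ = t - (s * (K / 2) * t + s * (K / 2))); first by lra.
  by field; rewrite gt_eqF.
rewrite mE; congr EFin; apply/eqP; rewrite eq_le -[0 <= m]oppr_le0.
apply/andP; split; apply: m_le0 => s s0; first by have := ms s; lra.
by have := ms (- s); rewrite sqrrN mulrN mulNr; lra.
Qed.

End subgaussian.

(** * Cramer-Rao bound for Gaussian observations *)

Section gaussian_cramer_rao.
Context {d} {Om : measurableType d} {R : realType} (P : probability Om R).
Context {a b : nat} (w : 'I_a + 'I_b -> {RV P >-> R}) (v : 'I_a + 'I_b -> R).
Hypothesis v_gt0 : forall i, 0 < v i.
Hypothesis gaussian_w : forall i, centered_gaussian (v i) (w i).
Hypothesis indep : mutually_independent w.
Variable h : 'I_a + 'I_b -> R.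
Local Notation Y := (a.-tuple R * b.-tuple R)%type.

Let V o := \sum_i h i * w i o.
Let K := \sum_i h i ^+ 2 * v i.
(** Least favourable direction: among shifts [c] with a given [\sum_i h i * c i], it minimizes
    [\sum_i c i ^+ 2 / v i]. *)
Let dir s i := s * h i * v i.

Let K_ge0 : 0 <= K.
Proof. by apply: sumr_ge0 => i _; rewrite mulr_ge0 ?sqr_ge0// ltW. Qed.

Let dir_sqr s : \sum_i dir s i ^+ 2 / v i = s ^+ 2 * K.
Proof.
rewrite mulr_sumr; apply: eq_bigr => i _.
by rewrite /dir; field; rewrite gt_eqF.
Qed.

(** Along [dir s] the ratio depends on the noise only through [V], since
    [dir s i / v i = s * h i]. *)
Let likelihood_ratio_dir s o :
  expR (s * V o) = expR (s ^+ 2 * (K / 2)) * likelihood_ratio w v (dir s) o.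
Proof.
rewrite likelihood_ratioE -expRD dir_sqr; congr expR.
rewrite (_ : \sum_i dir s i * w i o / v i = s * V o); first by field.
rewrite mulr_sumr; apply: eq_bigr => i _.
by rewrite /dir; field; rewrite gt_eqF.
Qed.

Let measurable_V : measurable_fun [set: Om] V.
Proof. by apply: measurable_sum => i; exact: measurable_funM. Qed.

Let mgf_V s :
  (\int[P]_o (expR (s * V o))%:E = (expR (s ^+ 2 * (K / 2)))%:E)%E.
Proof.
under eq_integral do rewrite likelihood_ratio_dir EFinM.
rewrite ge0_integralZl//= ?lee_fin ?expR_ge0//.
- by rewrite expectation_likelihood_ratio// mule1.
- exact/measurable_EFinP/measurable_likelihood_ratio.
- by move=> o _; rewrite lee_fin likelihood_ratio_ge0.
Qed.

Lemma linear_noise_integrable : P.-integrable [set: Om] (EFin \o V).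
Proof. exact: subgaussian_integrable mgf_V. Qed.

Lemma linear_noise_mean : (\int[P]_o (V o)%:E = 0)%E.
Proof. exact: subgaussian_mean mgf_V. Qed.

Lemma linear_noise_second_moment : (\int[P]_o (V o ^+ 2)%:E <= K%:E)%E.
Proof. exact: subgaussian_second_moment mgf_V. Qed.

Lemma gaussian_cramer_rao (q : 'I_a + 'I_b -> R) (T : Y -> R) (t : R) :
  measurable_fun [set: Y] T ->
  (forall s, P.-integrable [set: Om]
      (EFin \o (T \o observation w (q \+ dir s))) /\
    (\int[P]_o (T (observation w (q \+ dir s)%R o))%:E = (t + s * K)%:E)%E) ->
  (K%:E <= \int[P]_o ((T (observation w q o) - t) ^+ 2)%:E)%E.
Proof.
move=> mT unbT.
have mo := measurable_observation w.
have ET s : (\int[P]_o (T (observation w (q \+ dir s)%R o) - t)%:E = (s * K)%:E)%E.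
  have [iT eT] := unbT s.
  have it : P.-integrable [set: Om] (fun=> t%:E).
    exact: finite_measure_integrable_cst.
  under eq_integral do rewrite EFinB.
  rewrite (integralB measurableT iT it) eT.
  rewrite (_ : (\int[P]_ _ t%:E = t%:E)%E); last first.
    by rewrite -[RHS]mule1 -(probability_setT P) -integral_cst.
  by rewrite -EFinB; congr EFin; ring.
have dir0 : (q \+ dir 0) = q.
  by apply/funext => i; rewrite /= /dir !mul0r addr0.
(* An infinite mean squared error satisfies the bound trivially; otherwise it is a real number
   [M]. *)
have [Ioo|] := ltP (\int[P]_o ((T (observation w q o) - t) ^+ 2)%:E)%E +oo%E; last first.
  by move/(le_trans (leey _)).
set I := (\int[P]_o _)%E in Ioo *.
pose M := fine I.
have IM : I = M%:E.
  rewrite /M fineK// ge0_fin_numE//; apply: integral_ge0 => o _.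
  by rewrite lee_fin sqr_ge0.
have M0 : 0 <= M.
  by rewrite -lee_fin -IM; apply: integral_ge0 => o _; rewrite lee_fin sqr_ge0.
rewrite IM lee_fin; have [->//|K0] := eqVneq K 0.
have {}K0 : 0 < K by rewrite lt_neqAle eq_sym K0 K_ge0.
apply: (@le_small _ _ _ K K^-1); first by rewrite invr_gt0.
move=> r r0; rewrite -[K^-1]mul1r ltr_pdivlMr// => rK.
pose s := Num.sqrt r.
have sr : s ^+ 2 = r by rewrite sqr_sqrtr// ltW.
have := @covariance_sqr_le _ _ _ P (fun o => T (observation w q o) - t)
  (likelihood_ratio w v (dir s)) (s * K) M (expR (r * K)).
have mTo : measurable_fun [set: Om] (fun o => T (observation w q o) - t).
  by apply: measurable_funB => //; exact: measurableT_comp.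
move=> /(_ mTo (measurable_likelihood_ratio _ _ _)).
have sK0 : 0 <= s * K by rewrite mulr_ge0 ?sqrtr_ge0.
move=> /(_ sK0).
have E0 : (\int[P]_o (T (observation w q o) - t)%:E = 0)%E.
  by have := ET 0; rewrite dir0 mul0r.
have EZ2 : (\int[P]_o (likelihood_ratio w v (dir s) o ^+ 2)%:E = (expR (r * K))%:E)%E.
  by rewrite expectation_likelihood_ratio_sqr// dir_sqr sr.
(* By the change of measure this is the mean error under the shifted means, which is [s * K] by
   hypothesis. *)
have EXZ : (\int[P]_o ((T (observation w q o) - t) * likelihood_ratio w v (dir s) o)%:E
    = (s * K)%:E)%E.
  have mTt : measurable_fun [set: Y] (fun y => (T y - t)%:E).
    by apply/measurable_EFinP; exact: measurable_funB.
  rewrite -ET (integral_observation_shift v_gt0 gaussian_w indep q (dir s) mTt).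
  by apply: eq_integral => o _; rewrite EFinM.
move=> /(_ E0 (expectation_likelihood_ratio v_gt0 gaussian_w indep _) EXZ IM EZ2).
rewrite exprMn sr => hM.
have := expR_sub1_le (r * K); move: hM; set E := expR _ => hM hE.
(* Bounding [E - 1] by [expR_sub1_le] leaves a common factor [r * K] to cancel. *)
have hK : (1 - r * K) * (r * K ^+ 2) <= M * (r * K).
  apply: (@le_trans _ _ ((1 - r * K) * (M * (E - 1)))).
    by rewrite ler_pM2l//; lra.
  by rewrite mulrCA ler_wpM2l.
have rK0 : 0 < r * K by rewrite mulr_gt0.
rewrite -(ler_pM2r rK0).
by rewrite (_ : K * (1 - r * K) * (r * K) = (1 - r * K) * (r * K ^+ 2))//; ring.
Qed.

End gaussian_cramer_rao.

(** * IN/OUT releases *)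

Definition release_variance {R : realType} (n Lin Lout : nat)
    (vin vout : R) : R :=
  n.+1%:R ^+ 2 * vin / Lin%:R + n%:R ^+ 2 * vout / Lout%:R.

Section release_estimation.
Context {R : realType} {N n : nat} (j : 'I_N) (B : {set 'I_N}).
Hypotheses (jB : j \notin B) (Bn : #|B| = n) (n_gt0 : (1 <= n)%N).
Context {Lin Lout : nat}.
Hypotheses (Lin_gt0 : (1 <= Lin)%N) (Lout_gt0 : (1 <= Lout)%N).
Context {d : measure_display} {Om : measurableType d} (P : probability Om R).
Variable w : 'I_Lin + 'I_Lout -> {RV P >-> R}.
Variables (vin vout : R).
Hypotheses (vin_gt0 : 0 < vin) (vout_gt0 : 0 < vout).
Hypothesis gaussian_in : forall l, centered_gaussian vin (w (inl l)).
Hypothesis gaussian_out : forall l, centered_gaussian vout (w (inr l)).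
Hypothesis indep : mutually_independent w.

Let nR : n%:R != 0 :> R. Proof. by rewrite pnatr_eq0 -lt0n. Qed.
Let LinR : Lin%:R != 0 :> R. Proof. by rewrite pnatr_eq0 -lt0n. Qed.
Let LoutR : Lout%:R != 0 :> R. Proof. by rewrite pnatr_eq0 -lt0n. Qed.
Let SnR : n.+1%:R != 0 :> R. Proof. by rewrite pnatr_eq0. Qed.

Local Notation K := (release_variance n Lin Lout vin vout).

Let v (i : 'I_Lin + 'I_Lout) : R := if i is inl _ then vin else vout.
Let h (i : 'I_Lin + 'I_Lout) : R :=
  if i is inl _ then n.+1%:R / Lin%:R else - (n%:R / Lout%:R).
Let q (x : 'rV[R]_N) (i : 'I_Lin + 'I_Lout) : R :=
  if i is inl _ then q_in j B x else q_out B x.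

Let v_gt0 i : 0 < v i. Proof. by case: i. Qed.

Let gaussian_w i : centered_gaussian (v i) (w i). Proof. by case: i. Qed.

Let sum_h_sqr : \sum_i h i ^+ 2 * v i = K.
Proof.
rewrite big_sumType/= !sumr_const !card_ord /release_variance.
rewrite -[_ * vin *+ _]mulr_natr -[_ * vout *+ _]mulr_natr.
by field; rewrite LinR LoutR.
Qed.

Let record_queries (x : 'rV[R]_N) :
  n.+1%:R * q_in j B x - n%:R * q_out B x = x 0 j.
Proof. by rewrite /q_in /q_out Bn; field; rewrite nR nat1r SnR. Qed.

(** The two query values can be moved independently, so every shift constant on each block comes
    from some record vector. *)
Lemma shift_queries (x : 'rV[R]_N) (din dout : R) : exists x' : 'rV[R]_N,
  q_in j B x' = q_in j B x + din /\ q_out B x' = q_out B x + dout.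
Proof.
have /card_gt0P[m mB] : (0 < #|B|)%N by rewrite Bn.
have mj : m != j by apply: contraNneq jB => <-.
(* A background record [m] carries the change of the OUT sum; the target carries what remains of the
   change of the IN sum. *)
pose y k : R := if k == j then n.+1%:R * din - n%:R * dout
                else if k == m then n%:R * dout else 0.
have sumB : \sum_(k in B) y k = n%:R * dout.
  rewrite (bigD1 m)//= /y (negbTE mj) eqxx big1 ?addr0// => k /andP[kB km].
  by rewrite (negbTE km); case: eqP => // kj; move: jB; rewrite -kj kB.
exists (\row_k (x 0 k + y k)).
have sumE : \sum_(k in B) (\row_k (x 0 k + y k)) 0 k =
    \sum_(k in B) x 0 k + n%:R * dout.
  by rewrite -sumB -big_split/=; apply: eq_bigr => k _; rewrite mxE.
by rewrite /q_in /q_out sumE mxE Bn /y eqxx; split; field; rewrite ?nat1r ?nR ?SnR.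
Qed.

(** The least favourable shift is constant on each block, hence realized by some [x']; unbiasedness
    at [x'] supplies the mean that the Cramer-Rao bound asks for. *)
Lemma release_mse_ge T x : unbiased j B w T ->
  (K%:E <= mse j B w T x)%E.
Proof.
move=> [mT unbT]; rewrite /mse unlock -sum_h_sqr.
apply: (gaussian_cramer_rao v_gt0 gaussian_w indep (h := h) (q := q x)
  (t := x 0 j) mT) => s.
have [x' [xin xout]] := shift_queries x (s * (n.+1%:R / Lin%:R) * vin)
  (s * - (n%:R / Lout%:R) * vout).
have qE : q x \+ (fun i => s * h i * v i) = q x'.
  by apply/funext => -[] l /=; rewrite ?xin ?xout.
rewrite qE; have [iT eT] := unbT x'; split; first exact: iT.
rewrite unlock in eT; rewrite [LHS]eT; congr EFin.
rewrite -!record_queries xin xout sum_h_sqr /release_variance.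
by field; rewrite LinR LoutR.
Qed.

Let differenceE x o :
  difference_estimator n (releases j B w x o) = x 0 j + \sum_i h i * w i o.
Proof.
rewrite /difference_estimator /empirical_mean /releases/=.
under eq_bigr do rewrite tnth_mktuple.
under [X in _ - _ * (X / _)]eq_bigr do rewrite tnth_mktuple.
rewrite !big_split/= !sumr_const !card_ord big_sumType/= -!mulr_sumr.
rewrite -record_queries -[q_in j B x *+ _]mulr_natr -[q_out B x *+ _]mulr_natr.
by field; rewrite LinR LoutR.
Qed.

Let measurable_difference :
  measurable_fun [set: Lin.-tuple R * Lout.-tuple R] (difference_estimator n).
Proof.
apply: measurable_funB; apply: measurable_funM => //; apply: measurable_funM => //;
  apply: measurable_sum => l; apply: (measurableT_comp (measurable_tnth l)) => //.
Qed.

Lemma difference_estimator_unbiased : unbiased j B w (difference_estimator n).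
Proof.
split; first exact: measurable_difference.
move=> x; have iV := linear_noise_integrable v_gt0 gaussian_w indep h.
have ic : P.-integrable [set: Om] (fun=> (x 0 j)%:E).
  exact: finite_measure_integrable_cst.
have -> : difference_estimator n \o releases j B w x =
    (fun o => x 0 j + \sum_i h i * w i o).
  by apply/funext => o; exact: differenceE.
split.
  exact: (integrableD measurableT ic iV).
rewrite unlock; under eq_integral do rewrite EFinD.
rewrite (integralD measurableT ic iV) (linear_noise_mean v_gt0 gaussian_w indep).
by rewrite adde0 -[RHS]mule1 -(probability_setT P) -integral_cst.
Qed.

Lemma difference_estimator_mse x :
  mse j B w (difference_estimator n) x = K%:E.
Proof.
apply/eqP; rewrite eq_le release_mse_ge ?andbT; last first.
  exact: difference_estimator_unbiased.
rewrite /mse unlock -sum_h_sqr.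
apply: le_trans (linear_noise_second_moment v_gt0 gaussian_w indep h).
rewrite le_eqVlt; apply/orP; left; apply/eqP/eq_integral => o _.
by rewrite differenceE addrC addKr.
Qed.

End release_estimation.

(** * Calibrated bound and balanced splits *)

(** For positive even [L] the quotients add up to [L - 1], so the sum rules it out; [1 <= a] rules
    out [L = 0], where subtraction truncates. *)
Lemma nearest_balanced_split (L a b : nat) : (1 <= a)%N -> L = (a + b)%N ->
  a = ((L - 1) %/ 2)%N -> b = ((L + 1) %/ 2)%N -> b = a.+1.
Proof. lia. Qed.

Theorem proposition2 (R : realType) (N n : nat) (j : 'I_N) (B : {set 'I_N})
    (Delta eps_tot delta_tot : R) (L Lin Lout : nat)
    (d : measure_display) (Om : measurableType d) (P : probability Om R)
    (w : 'I_Lin + 'I_Lout -> {RV P >-> R}) :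
  j \notin B -> #|B| = n -> (1 <= n)%N ->
  0 < Delta -> 0 < eps_tot -> 0 < delta_tot -> delta_tot < 1 ->
  (1 <= Lin)%N -> (1 <= Lout)%N -> L = (Lin + Lout)%N ->
  release_noise j B Delta eps_tot delta_tot w ->
  [/\ forall T, unbiased j B w T ->
        forall x, ((mse_bound L Delta eps_tot delta_tot)%:E <= mse j B w T x)%E,
      ~~ odd L -> Lin = L./2 -> Lout = L./2 ->
        unbiased j B w (difference_estimator n) /\
        forall x, mse j B w (difference_estimator n) x
                  = (mse_bound L Delta eps_tot delta_tot)%:E &
      odd L ->
      (Lin = ((L - 1) %/ 2)%N /\ Lout = ((L + 1) %/ 2)%N) \/
      (Lin = ((L + 1) %/ 2)%N /\ Lout = ((L - 1) %/ 2)%N) ->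
        let bound := mse_bound L Delta eps_tot delta_tot
                     * (L%:R ^+ 2 / (L%:R ^+ 2 - 1)) in
        (forall T, unbiased j B w T ->
           forall x, (bound%:E <= mse j B w T x)%E) /\
        exists2 T, unbiased j B w T & forall x, mse j B w T x = bound%:E].
Proof.
move=> jB Bn n0 D0 e0 d0 d1 Lin0 Lout0 LE [gin gout indep].
rewrite (sensitivity_q_in jB (ltW D0)) Bn in gin.
rewrite (sensitivity_q_out _ (ltW D0)) ?Bn// in gout.
rewrite !ubc_varianceE -LE in gin gout.
set lnL := ln (5 / 4 * L%:R / delta_tot) in gin gout *.
have L1 : 1 <= L%:R :> R by rewrite ler1n LE addn_gt0 Lin0.
have lnL0 : 0 < lnL.
  by rewrite ln_gt0// ltr_pdivlMr// mul1r; lra.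
set vin := _ * (_ / n.+1%:R) ^+ 2 in gin.
set vout := _ * (_ / n%:R) ^+ 2 in gout.
have nR : 0 < n%:R :> R by rewrite ltr0n.
have SnR : 0 < n.+1%:R :> R by rewrite ltr0n.
have LinR : 0 < Lin%:R :> R by rewrite ltr0n.
have LoutR : 0 < Lout%:R :> R by rewrite ltr0n.
have LR : 0 < L%:R :> R by exact: lt_le_trans L1.
have kappa0 : 0 < 2 * L%:R ^+ 2 * lnL / eps_tot ^+ 2.
  by rewrite divr_gt0 ?exprn_gt0// !mulr_gt0// exprn_gt0.
have vin0 : 0 < vin by rewrite mulr_gt0// exprn_gt0// divr_gt0.
have vout0 : 0 < vout by rewrite mulr_gt0// exprn_gt0// divr_gt0.
have LRE : L%:R = Lin%:R + Lout%:R :> R by rewrite LE natrD.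
pose M := release_variance n Lin Lout vin vout.
(* The weights [n.+1] and [n] cancel against the sensitivities, so the split matters only through
   [Lin * Lout]. *)
have ME : M = mse_bound L Delta eps_tot delta_tot *
    (L%:R ^+ 2 / (4 * Lin%:R * Lout%:R)).
  rewrite /M /release_variance /vin /vout /mse_bound -/lnL LRE.
  by field; rewrite ?nat1r !gt_eqF ?addr_gt0.
have bound0 : 0 < mse_bound L Delta eps_tot delta_tot.
  by rewrite /mse_bound -/lnL divr_gt0 ?exprn_gt0// !mulr_gt0// exprn_gt0.
have ge T : unbiased j B w T -> forall x, (M%:E <= mse j B w T x)%E.
  by move=> uT x; exact: release_mse_ge.
have unb : unbiased j B w (difference_estimator n).
  exact: (difference_estimator_unbiased j Bn n0 Lin0 Lout0 vin0 vout0).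
have eqM x : mse j B w (difference_estimator n) x = M%:E.
  exact: difference_estimator_mse.
split.
- move=> T uT x; apply: le_trans (ge T uT x); rewrite lee_fin ME.
  rewrite ler_pMr// ler_pdivlMr ?mulr_gt0// mul1r LRE.
  (* This is [4 * Lin * Lout <= (Lin + Lout) ^+ 2]. *)
  by have := sqr_ge0 (Lin%:R - Lout%:R : R); lra.
- move=> _ LinE LoutE; split=> // x; rewrite eqM ME LRE.
  have -> : Lout = Lin by rewrite LinE LoutE.
  by congr EFin; field; rewrite gt_eqF.
- move=> oddL splitL bound.
  suff -> : bound = M by split => //; exists (difference_estimator n).
  (* Consecutive block sizes [a] and [a + 1] give [L ^+ 2 - 1 = 4 * a * (a + 1)], in either
     order. *)
  rewrite /bound ME; congr (_ * (_ / _)); rewrite LRE.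
  case: splitL => -[LinE LoutE].
    rewrite (nearest_balanced_split Lin0 _ LinE LoutE)// -natr1; ring.
  rewrite (nearest_balanced_split Lout0 _ LoutE LinE) -?natr1; first by ring.
  by rewrite addnC.
Qed.
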